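(* Let $p,q,r\in\mathbb{Q}$ with $x^3-px^2-qx-r$ irreducible over $\mathbb{Q}$, and let $\alpha$ be a real root of it whose modulus is strictly larger than the moduli of the remaining roots $\alpha_2,\alpha_3$. Let $z$ be a nonzero integer with $|z+\alpha^2|>|z+\alpha_2^2|$, $|z+\alpha^2|>|z+\alpha_3^2|$, and $\mu_n^{(2)}\neq0$ for all $n\ge1$, where $(z+\alpha^2)^n=\mu_n^{(0)}+\mu_n^{(1)}\alpha+\mu_n^{(2)}\alpha^2$ with $\mu_n^{(i)}\in\mathbb{Q}$. Put $$T=p^2+2q+3z,\quad I=q^2-2pr+2p^2z+4qz+3z^2,\quad D=r^2+q^2z-2prz+p^2z^2+2qz^2+z^3$$ (the trace, the sum of principal $2\times 2$ minors, and the determinant of $N=\begin{pmatrix} z & r & pr \\ 0 & q+z & pq+r \\ 1 & p & p^2+q+z \end{pmatrix}$). Define sequences $(a_n)_{n\ge0},(b_n)_{n\ge0}$ by $$a_0=z,\quad a_1=\frac{2z+p^2+q}{pq+r},\quad b_0=p,\quad b_1=-\frac{z^2+qz+p^2z-pr}{pq+r},$$ and for all $k\ge0$ $$a_{3k+2}=\frac{(pq+r)T}{D},\ a_{3k+3}=T,\ a_{3k+4}=\frac{T}{pq+r},\qquad b_{3k+2}=-\frac{I}{D},\ b_{3k+3}=-\frac{(pq+r)I}{D},\ b_{3k+4}=-\frac{I}{pq+r}.$$ Then the ternary continued fraction $[\{a_0,a_1,\dots\},\{b_0,b_1,\dots\}]$ converges to $\left(\frac{r}{\alpha},\alpha\r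ight)$.
   Context: Ternary continued fractions: for sequences $(a_n)_{n\ge0},(b_n)_{n\ge0}$ of real numbers define $A_n,B_n,C_n$ by $A_n=a_nA_{n-1}+b_nA_{n-2}+A_{n-3}$, $B_n=a_nB_{n-1}+b_nB_{n-2}+B_{n-3}$, $C_n=a_nC_{n-1}+b_nC_{n-2}+C_{n-3}$ for $n\ge1$, with initial values $A_{-2}=1,A_{-1}=0,A_0=a_0$; $B_{-2}=0,B_{-1}=1,B_0=b_0$; $C_{-2}=0,C_{-1}=0,C_0=1$. The pair $(A_n/C_n,B_n/C_n)$ is the $n$-th convergent, and the ternary continued fraction $[\{a_0,a_1,\dots\},\{b_0,b_1,\dots\}]$ is said to converge to $(x,y)$ if $A_n/C_n\to x$ and $B_n/C_n\to y$ as $n\to\infty$. Equivalently $\prod_{i=0}^n\begin{pmatrix} a_i&1&0\\ b_i&0&1\\ 1&0&0\end{pmatrix}=\begin{pmatrix} A_n&A_{n-1}&A_{n-2}\\ B_n&B_{n-1}&B_{n-2}\\ C_n&C_{n-1}&C_{n-2}\end{pmatrix}$.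
   Formalization: The initial values are taken from the matrix product, A_{-2}=0, A_{-1}=1, B_{-2}=1, B_{-1}=0; the listed values A_{-2}=1, A_{-1}=0, B_{-2}=0, B_{-1}=1 contradict it and make the claim false (for p=q=r=z=1 the limit would be (α, r/α)). *)

(* Defs.v *)
From mathcomp Require Import all_boot all_order all_algebra.
From mathcomp Require Import complex.
From mathcomp Require Import all_classical all_reals all_analysis.

Set Implicit Arguments.
Unset Strict Implicit.
Unset Printing Implicit Defensive.

Import Order.TTheory GRing.Theory Num.Theory.
Import numFieldNormedType.Exports.

Local Open Scope classical_set_scope.
Local Open Scope ring_scope.

Section TernaryContinuedFraction.
Variable R : realType.
Implicit Types a b : nat -> R.

(* The solution X of X_n = a_n X_(n-1) + b_n X_(n-2) + X_(n-3) (n >= 1) with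
   (X_(-2), X_(-1), X_0) = (x, y, w), indexed with a shift of two:
   tcf_rec a b x y w m = X_(m-2). *)
Fixpoint tcf_rec a b (x y w : R) (m : nat) : R :=
  match m with
  | 0 => x
  | m1.+1 =>
    match m1 with
    | 0 => y
    | m2.+1 =>
      match m2 with
      | 0 => w
      | m3.+1 => a m3.+1 * tcf_rec a b x y w m1
                 + b m3.+1 * tcf_rec a b x y w m2 + tcf_rec a b x y w m3
      end
    end
  end.

(* A, B and C have initial values (index -2, -1, 0) equal to (0, 1, a_0),
   (1, 0, b_0) and (0, 0, 1), as dictated by the case n = 0 of the matrix
   identity tcf_prodE below, whose right-hand side has rows
   (A_n, A_(n-1), A_(n-2)), (B_n, B_(n-1), B_(n-2)), (C_n, C_(n-1), C_(n-2)).
   Exchanging the values of index -2 and -1 in A and B breaks that identity. *)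
Definition tcfA_shift a b : nat -> R := tcf_rec a b 0 1 (a 0%N).
Definition tcfB_shift a b : nat -> R := tcf_rec a b 1 0 (b 0%N).
Definition tcfC_shift a b : nat -> R := tcf_rec a b 0 0 1.

Definition tcfA a b (n : nat) : R := tcfA_shift a b n.+2.
Definition tcfB a b (n : nat) : R := tcfB_shift a b n.+2.
Definition tcfC a b (n : nat) : R := tcfC_shift a b n.+2.

Definition mx33 (s : seq (seq R)) : 'M[R]_3 :=
  \matrix_(i < 3, j < 3) nth 0 (nth [::] s i) j.

Lemma tcf_prodE a b (n : nat) :
  \prod_(i < n.+1) mx33 [:: [:: a i; 1; 0];
                            [:: b i; 0; 1];
                            [:: 1; 0; 0]] =
  mx33 [:: [:: tcfA a b n; tcfA_shift a b n.+1; tcfA_shift a b n];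
           [:: tcfB a b n; tcfB_shift a b n.+1; tcfB_shift a b n];
           [:: tcfC a b n; tcfC_shift a b n.+1; tcfC_shift a b n]].
Proof.
elim: n => [|n IHn]; first by rewrite big_ord1.
rewrite big_ord_recr /= IHn; apply/matrixP => i j; rewrite !mxE.
rewrite !big_ord_recl big_ord0 !mxE /=.
case: i => [[|[|[|//]]] ?]; case: j => [[|[|[|//]]] ?] /=;
  rewrite ?(mulr0, mulr1, addr0, add0r) //= addrA;
  by congr (_ + _ + _); rewrite mulrC.
Qed.

(* The first conjunct guards against the convention u / 0 = 0: the convergents
   have to be defined from some index on. *)
Definition tcf_converges a b (x y : R) : Prop :=
  [/\ \forall n \near \oo, tcfC a b n != 0,
      (fun n => tcfA a b n / tcfC a b n) @ \oo --> x &
      (fun n => tcfB a b n / tcfC a b n) @ \oo --> y].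

End TernaryContinuedFraction.

Definition cubic (p q r : rat) : {poly rat} :=
  'X^3 - p *: 'X^2 - q *: 'X - r%:P.

(* Trace, sum of the principal 2x2 minors and determinant of multiplication by
   z + alpha^2 on Q(alpha), for alpha a root of cubic p q r. *)
Definition cubicT (p q z : rat) : rat := p ^+ 2 + 2 * q + 3 * z.
Definition cubicI (p q r z : rat) : rat :=
  q ^+ 2 - 2 * p * r + 2 * p ^+ 2 * z + 4 * q * z + 3 * z ^+ 2.
Definition cubicD (p q r z : rat) : rat :=
  r ^+ 2 + q ^+ 2 * z - 2 * p * r * z + p ^+ 2 * z ^+ 2 + 2 * q * z ^+ 2
  + z ^+ 3.

(* Main.v *)
(** Rescaling the recurrence by a suitable sequence c_n (tcf_scale) turns it into
    Y_(n+3) = T Y_(n+2) - I Y_(n+1) + D Y_n, whose characteristic roots are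
    beta_i = z + alpha_i^2. As beta = z + alpha^2 is strictly dominant,
    Y_n / beta^n converges to (Y_2 - S Y_1 + P Y_0) / (beta^2 - S beta + P) with
    S = beta_2 + beta_3 and P = beta_2 beta_3. The numerator is
    (alpha + alpha_2) (alpha + alpha_3) != 0 for C, and r / alpha, respectively
    alpha, times this value for A and B. *)
Require Import Defs.
From mathcomp Require Import all_boot all_order all_algebra.
From mathcomp Require Import complex ring lra.
From mathcomp Require Import all_classical all_reals all_analysis.

Set Implicit Arguments.
Unset Strict Implicit.
Unset Printing Implicit Defensive.

Import Order.TTheory GRing.Theory Num.Theory.
Import numFieldNormedType.Exports.

Local Open Scope ring_scope.
Local Open Scope complex_scope.

(** * Nonvanishing of [p * q + r] and of the determinant [D] *)

(** With f the cubic and w^2 = -z, f(w) = (p z - r) - (z + q) w, so the right-hand side is f(w)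
    f(-w). *)
Lemma cubicDE (p q r z : rat) :
  cubicD p q r z = (p * z - r) ^+ 2 + z * (z + q) ^+ 2.
Proof. rewrite /cubicD; ring. Qed.

Lemma horner_cubic (p q r x : rat) :
  (cubic p q r).[x] = x ^+ 3 - p * x ^+ 2 - q * x - r.
Proof. by rewrite /cubic !hornerE. Qed.

Lemma size_cubic (p q r : rat) : size (cubic p q r) = 4%N.
Proof.
rewrite /cubic -!addrA size_polyDl ?size_polyXn //.
rewrite -!opprD size_polyN.
rewrite (leq_ltn_trans (size_polyD _ _)) // gtn_max.
rewrite (leq_ltn_trans (size_scale_leq _ _)) ?size_polyXn //=.
rewrite (leq_ltn_trans (size_polyD _ _)) // gtn_max.
rewrite (leq_ltn_trans (size_scale_leq _ _)) ?size_polyX //=.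
by rewrite (leq_ltn_trans (size_polyC_leq1 _)).
Qed.

Lemma cubic_no_root (p q r x : rat) :
  irreducible_poly (cubic p q r) -> x ^+ 3 - p * x ^+ 2 - q * x - r != 0.
Proof.
move=> [_ irr]; apply/negP; rewrite -horner_cubic => rx.
have /irr : size ('X - x%:P) != 1%N by rewrite size_XsubC.
rewrite dvdp_XsubCl => /(_ rx) /eqp_size.
by rewrite size_XsubC size_cubic.
Qed.

(** The cubic takes the value [- (p * q + r)] at the rational point [p]. *)
Lemma cubic_pq_r_neq0 (p q r : rat) :
  irreducible_poly (cubic p q r) -> p * q + r != 0.
Proof.
move=> /(@cubic_no_root _ _ _ p); apply: contra => /eqP h.
by apply/eqP; rewrite -[RHS]oppr0 -h; ring.
Qed.

(** If D = 0, then either z + q = 0, which forces p q + r = 0, or -z is the square of the rational t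
    = (p z - r) / (z + q), and this t is a root of the cubic. *)
Lemma cubicD_neq0 (p q r z : rat) :
  irreducible_poly (cubic p q r) -> cubicD p q r z != 0.
Proof.
move=> irr; rewrite cubicDE; apply/negP => /eqP D0.
have [zq|zq] := eqVneq (z + q) 0.
  have qE : q = - z by apply/eqP; rewrite -addr_eq0 addrC zq.
  move: D0; rewrite zq expr0n mulr0 addr0 => /eqP; rewrite sqrf_eq0 => /eqP h.
  move: (cubic_pq_r_neq0 irr); rewrite qE => /eqP; apply.
  by rewrite -[RHS]oppr0 -h; ring.
set t := (p * z - r) / (z + q).
have tE : t * (z + q) = p * z - r by rewrite /t divfK.
have t2 : t ^+ 2 = - z.
  apply: (mulIf (expf_neq0 2 zq)); rewrite -exprMn tE.
  by apply/eqP; rewrite -subr_eq0 mulNr opprK D0.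
move: (cubic_no_root t irr) => /eqP; apply.
have -> : t ^+ 3 - p * t ^+ 2 - q * t - r
  = (t - p) * (t ^+ 2 + z) - (t * (z + q) - (p * z - r)) by ring.
by rewrite t2 tE addNr mulr0 subrr subr0.
Qed.

(** * Linear recurrences with a dominant characteristic root *)

(** To treat conjugate and equal roots alike, no closed form is used: e_(n+1) - g e_n is geometric
    of ratio h, whence |e_(n+1)| <= rho |e_n| + K rho^n with rho = max(|g|, |h|). *)
Lemma cvg0_rec2 (R : realType) (g h : R[i]) (e : nat -> R) :
  `|g| < 1 -> `|h| < 1 ->
  (forall n, (e n.+2)%:C = (g + h) * (e n.+1)%:C - g * h * (e n)%:C) ->
  (e n @[n --> \oo] --> 0)%classic.
Proof.
move=> g1 h1 eE.
have [ng ngE] : exists x : R, `|g| = x%:C by eexists; exact: normc_def.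
have [nh nhE] : exists x : R, `|h| = x%:C by eexists; exact: normc_def.
pose rho := Num.max ng nh.
have grho : `|g| <= rho%:C by rewrite ngE lecR le_max lexx.
have hrho : `|h| <= rho%:C by rewrite nhE lecR le_max lexx orbT.
have rho_ge0 : 0 <= rho by rewrite -lecR; apply: le_trans (normr_ge0 g) grho.
have rho1 : rho < 1.
  by move: g1 h1; rewrite ngE nhE -[1]/(1%:C) !ltcR gt_max => -> ->.
have fE n : (e n.+1)%:C - g * (e n)%:C = h ^+ n * ((e 1)%:C - g * (e 0)%:C).
  elim: n => [|n IHn]; first by rewrite expr0 mul1r.
  by rewrite exprS -mulrA -IHn eE; ring.
have [K KE] : exists x : R, `|(e 1)%:C - g * (e 0)%:C| = x%:C.
  by eexists; exact: normc_def.
have K_ge0 : 0 <= K by rewrite -lecR -KE; exact: normr_ge0.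
(* Any ratio strictly between [rho] and 1 would do; the gap absorbs the growth n rho^n caused by a
   double root. *)
pose sigma := (1 + rho) / 2.
have sigma_gt : rho < sigma by rewrite /sigma; lra.
have sigma1 : sigma < 1 by rewrite /sigma; lra.
have sigma_gt0 : 0 < sigma by apply: le_lt_trans sigma_gt.
(* The first summand covers the base case of [bound], the second gives [KM], which closes its
   induction step. *)
pose M := `|e 0| + K / (sigma - rho).
have KM : K <= M * (sigma - rho).
  rewrite /M mulrDl divfK ?subr_eq0 ?gt_eqF // lerDr mulr_ge0 //.
  by rewrite subr_ge0 ltW.
have bound n : `|e n| <= M * sigma ^+ n.
  elim: n => [|n IHn].
    by rewrite expr0 mulr1 /M lerDl divr_ge0 // subr_ge0 ltW.
  have step : `|e n.+1| <= rho * `|e n| + rho ^+ n * K.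
    have normE (x : R) : (`|x|)%:C = `|x%:C|.
      by rewrite normc_def /= expr0n addr0 sqrtr_sqr.
    rewrite -lecR rmorphD !rmorphM rmorphXn /= !normE -KE.
    rewrite -[(e n.+1)%:C](subrK (g * (e n)%:C)) addrC fE.
    apply: le_trans (ler_normD _ _) _; rewrite !normrM normrX.
    apply: lerD; apply: ler_wpM2r => //.
    by apply: lerXn2r; rewrite ?nnegrE // -[0]/(0%:C) lecR.
  apply: le_trans step _.
  have pow : rho ^+ n <= sigma ^+ n.
    by apply: lerXn2r; rewrite ?nnegrE // ltW.
  have spow : 0 <= sigma ^+ n by rewrite exprn_ge0 // ltW.
  apply: (@le_trans _ _ (rho * (M * sigma ^+ n) + sigma ^+ n * K)).
    by apply: lerD; [exact: ler_wpM2l | exact: ler_wpM2r].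
  rewrite exprS.
  have -> : M * (sigma * sigma ^+ n) =
    rho * (M * sigma ^+ n) + sigma ^+ n * (M * (sigma - rho)) by ring.
  by rewrite lerD2l ler_wpM2l.
apply: norm_cvg0.
apply: (@squeeze_cvgr _ _ _ _ (fun=> 0) (geometric M sigma)).
- by near=> n; rewrite normr_ge0 /= bound.
- exact: cvg_cst.
- by apply: cvg_geometric; rewrite ger0_norm // ltW.
Unshelve. all: by end_near. Qed.

(** The value is (x - g)(x - h); it serves as denominator of the limit below. *)
Lemma quadratic_neq0 (R : realType) (x S P : R) (g h : R[i]) :
  S%:C = g + h -> P%:C = g * h -> `|g| < `|x%:C| -> `|h| < `|x%:C| ->
  x ^+ 2 - S * x + P != 0.
Proof.
move=> SE PE gx hx; set Q := _ + P.
have QE : Q%:C = (x%:C - g) * (x%:C - h).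
  by rewrite /Q rmorphD rmorphB rmorphXn rmorphM /= SE PE; ring.
have : Q%:C != 0.
  rewrite QE mulf_neq0 // subr_eq0.
    by apply: contraTneq gx => ->; rewrite ltxx.
  by apply: contraTneq hx => ->; rewrite ltxx.
by apply: contraNneq => ->.
Qed.

(** The characteristic polynomial is (X - x)(X^2 - S X + P). Applying the quadratic factor to y
    leaves the geometric sequence x^n F, so y_n / x^n - F / Q satisfies a recurrence of order two
    with roots g / x and h / x in the open unit disc. *)
Lemma cvg_rec3_dominant (R : realType) (x S P : R) (g h : R[i]) (y : nat -> R) :
  S%:C = g + h -> P%:C = g * h -> `|g| < `|x%:C| -> `|h| < `|x%:C| ->
  (forall n, y n.+3 = (x + S) * y n.+2 - (x * S + P) * y n.+1 + x * P * y n) ->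
  (y n / x ^+ n @[n --> \oo] -->
    (y 2%N - S * y 1%N + P * y 0%N) / (x ^+ 2 - S * x + P))%classic.
Proof.
move=> SE PE gx hx yE.
have xC0 : x%:C != 0 by rewrite -normr_gt0 (le_lt_trans _ gx).
have x0 : x != 0 by apply: contraNneq xC0 => ->.
set F := _ - _ + _; set Q := _ - _ + P.
have Q0 : Q != 0 := quadratic_neq0 SE PE gx hx.
have FE n : y n.+2 - S * y n.+1 + P * y n = x ^+ n * F.
  elim: n => [|n IHn]; first by rewrite expr0 mul1r.
  by rewrite exprS -mulrA -IHn yE; ring.
rewrite -[X in (_ --> X)%classic]addr0.
rewrite (_ : (fun n => _) = (fun n => F / Q + (y n / x ^+ n - F / Q)));
  last by apply/funext => n; rewrite addrC subrK.
apply: cvgD; first exact: cvg_cst.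
apply: (@cvg0_rec2 _ (g / x%:C) (h / x%:C)).
- by rewrite normrM normfV ltr_pdivrMr ?mul1r ?normr_gt0.
- by rewrite normrM normfV ltr_pdivrMr ?mul1r ?normr_gt0.
move=> n; set u := fun n => y n / x ^+ n - F / Q.
have uE : u n.+2 = S / x * u n.+1 - P / x ^+ 2 * u n.
  have y2E : y n.+2 = S * y n.+1 - P * y n + x ^+ n * F by rewrite -FE; ring.
  rewrite /u y2E.
  have xn0 : x ^+ n != 0 by rewrite expf_neq0.
  rewrite -(addn2 n) -(addn1 n) !exprD expr1 /Q; field.
  by rewrite x0 xn0 /= andbT.
rewrite -/(u n.+2) -/(u n.+1) -/(u n) uE.
rewrite rmorphB !rmorphM /= !fmorphV rmorphXn /= SE PE.
by field.
Qed.

(** * Rescaling to constant coefficients *)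

(* The solution of a_n c_(n-1) = T c_n, b_n c_(n-2) = - I c_n and
   c_(n-3) = D c_n, where tcf_scale s D m stands for c_(m-1). *)
Fixpoint tcf_scale (R : realType) (s D : R) (m : nat) : R :=
  match m with
  | 0 => 1
  | 1 => 1
  | 2 => s^-1
  | m'.+3 => tcf_scale s D m' / D
  end.

Lemma tcf_scale_neq0 (R : realType) (s D : R) m :
  s != 0 -> D != 0 -> tcf_scale s D m != 0.
Proof.
move=> s0 D0; have [k] := ubnP m; elim: k m => // k IHk [|[|[|m]]] /= mk.
- exact: oner_neq0.
- exact: oner_neq0.
- by rewrite invr_neq0.
- by rewrite mulf_neq0 ?invr_neq0 // IHk // ltnW // ltnW.
Qed.

Lemma tcf_scale_mul3D (R : realType) (s D : R) k i :
  tcf_scale s D (3 * k + i) = tcf_scale s D i / D ^+ k.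
Proof.
elim: k => [|k IHk]; first by rewrite muln0 expr0 divr1.
by rewrite mulnS -addnA /= IHk exprSr invfM mulrA.
Qed.

(** [Y] starts at X_(-1), so its recurrence involves a_n and b_n for n >= 2 only, where they have
    period three. *)
Lemma tcf_rec_scaled (R : realType) (s T I D x y w : R) (a b : nat -> R) :
  s != 0 -> D != 0 ->
  (forall k, a (3 * k + 2)%N = s * T / D) ->
  (forall k, a (3 * k + 3)%N = T) ->
  (forall k, a (3 * k + 4)%N = T / s) ->
  (forall k, b (3 * k + 2)%N = - (I / D)) ->
  (forall k, b (3 * k + 3)%N = - (s * I / D)) ->
  (forall k, b (3 * k + 4)%N = - (I / s)) ->
  let Y m := tcf_rec a b x y w m.+1 / tcf_scale s D m in
  forall m, Y m.+3 = T * Y m.+2 - I * Y m.+1 + D * Y m.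
Proof.
move=> s0 D0 a2 a3 a4 b2 b3 b4 Y m.
pose c := tcf_scale s D.
have cD j : c j = D * c j.+3 by rewrite /c /= mulrC divfK.
have [ca cb] : a m.+2 * c m.+2 = T * c m.+3 /\ b m.+2 * c m.+1 = - I * c m.+3.
  have : (m %% 3 < 3)%N by rewrite ltn_mod.
  (* Every [m] becomes 3 k + i except the one in the bound on the remainder, which is kept for the
     case analysis on i. *)
  rewrite {2 3 4 5 6 7}(divn_eq m 3) mulnC -!addnS; set k := (m %/ 3)%N.
  have Dk : D ^+ k != 0 by rewrite expf_neq0.
  rewrite /c !tcf_scale_mul3D.
  case: (m %% 3)%N => [|[|[|//]]] _; rewrite /= ?a2 ?a3 ?a4 ?b2 ?b3 ?b4;
    by split; field; rewrite ?s0 ?D0 ?Dk.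
have c3 : c m.+3 != 0 by exact: tcf_scale_neq0.
have c2 : c m.+2 != 0 by exact: tcf_scale_neq0.
have c1 : c m.+1 != 0 by exact: tcf_scale_neq0.
have c0 : c m != 0 by exact: tcf_scale_neq0.
rewrite /Y -/(c m.+3) -/(c m.+2) -/(c m.+1) -/(c m).
have -> : tcf_rec a b x y w m.+4 = a m.+2 * tcf_rec a b x y w m.+3
  + b m.+2 * tcf_rec a b x y w m.+2 + tcf_rec a b x y w m.+1 by [].
have -> : a m.+2 = T * c m.+3 / c m.+2 by rewrite -ca mulfK.
have -> : b m.+2 = - I * c m.+3 / c m.+1 by rewrite -cb mulfK.
move: c0; rewrite [c m]cD => c0.
by field; rewrite c1 c2 c3 D0.
Qed.

(** * Vieta's formulas and limits of quotients *)

(** Evaluating the factorization at 0, 1 and -1 yields the coefficients. *)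
Lemma cubic_vieta (R : realType) (p q r : rat) (x : R) (x2 x3 : R[i]) :
  map_poly ratr (cubic p q r) =
    ('X - (x%:C)%:P) * ('X - x2%:P) * ('X - x3%:P) :> {poly R[i]} ->
  exists u v : R, [/\ u%:C = x2 + x3, v%:C = x2 * x3, ratr p = x + u,
    ratr q = - (x * u + v) & ratr r = x * v].
Proof.
move=> roots.
have ev (t : R[i]) : t ^+ 3 - ratr p * t ^+ 2 - ratr q * t - ratr r
    = (t - x%:C) * (t - x2) * (t - x3).
  move: (congr1 (horner^~ t) roots).
  rewrite /cubic !rmorphB /= !map_polyZ /= !map_polyXn map_polyX map_polyC /=.
  by rewrite !(hornerD, hornerN, hornerZ, hornerM, hornerXn, hornerX, hornerC).
have ratC (c : rat) : ratr c = (ratr c : R)%:C.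
  by rewrite (fmorph_rat (real_complex R)).
have rE : ratr r = x%:C * x2 * x3.
  apply: oppr_inj.
  transitivity ((0 - x%:C) * (0 - x2) * (0 - x3)); last by ring.
  by rewrite -ev; ring.
have pE : ratr p = x%:C + x2 + x3.
  apply: (@mulfI _ (- 2)); first by rewrite oppr_eq0 pnatr_eq0.
  transitivity ((1 - x%:C) * (1 - x2) * (1 - x3) +
    (-1 - x%:C) * (-1 - x2) * (-1 - x3) + 2 * ratr r); last by rewrite rE; ring.
  by rewrite -!ev; ring.
have qE : ratr q = - (x%:C * (x2 + x3) + x2 * x3).
  apply: oppr_inj; transitivity ((1 - x%:C) * (1 - x2) * (1 - x3) - 1
     + ratr p + ratr r); last by rewrite rE pE; ring.
  by rewrite -!ev; ring.
(* Solving Vieta's formulas for the two unknowns gives witnesses that are real by construction. *)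
exists (ratr p - x), (- ratr q - x * (ratr p - x)).
have uE : (ratr p - x)%:C = x2 + x3 by rewrite rmorphB /= -ratC pE; ring.
have vE : (- ratr q - x * (ratr p - x))%:C = x2 * x3.
  by rewrite rmorphB rmorphM rmorphN /= -ratC uE qE; ring.
split => //; [by ring | by ring |].
by apply: (@complexI R); rewrite [RHS]rmorphM /= vE -ratC rE mulrA.
Qed.

Lemma cvg_ratio_dominant (R : realType) (x lf lg l : R) (f g : nat -> R) :
  x != 0 -> lg != 0 -> lf = l * lg ->
  (f n / x ^+ n @[n --> \oo] --> lf)%classic ->
  (g n / x ^+ n @[n --> \oo] --> lg)%classic ->
  (f n / g n @[n --> \oo] --> l)%classic.
Proof.
move=> x0 lg0 lE cf cg.
have -> : l = lf / lg by rewrite lE mulfK.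
rewrite (_ : (fun n => _) = (fun n => f n / x ^+ n / (g n / x ^+ n))).
  by apply: cvgM => //; apply: cvgV.
apply/funext => n; have xn0 : x ^+ n != 0 by rewrite expf_neq0.
by rewrite invf_div mulrA divfK.
Qed.

(** * Convergence of the ternary continued fraction *)

Theorem theorem4 (R : realType) (p q r : rat) (alpha : R) (alpha2 alpha3 : R[i])
    (z : int) (mu0 mu1 mu2 : nat -> rat) (a b : nat -> rat)
    (zQ := z%:~R : rat)
    (T := cubicT p q zQ) (I := cubicI p q r zQ) (D := cubicD p q r zQ)
    (irr : irreducible_poly (cubic p q r))
    (roots : map_poly ratr (cubic p q r) =
       ('X - (alpha%:C)%:P) * ('X - alpha2%:P) * ('X - alpha3%:P)
       :> {poly R[i]})
    (dom2 : `|alpha2| < `|alpha%:C|)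
    (dom3 : `|alpha3| < `|alpha%:C|)
    (z_neq0 : z != 0)
    (zdom2 : `|z%:~R + alpha2 ^+ 2| < `|z%:~R + alpha%:C ^+ 2|)
    (zdom3 : `|z%:~R + alpha3 ^+ 2| < `|z%:~R + alpha%:C ^+ 2|)
    (muE : forall n : nat, (z%:~R + alpha ^+ 2) ^+ n =
       ratr (mu0 n) + ratr (mu1 n) * alpha + ratr (mu2 n) * alpha ^+ 2)
    (mu2_neq0 : forall n : nat, (1 <= n)%N -> mu2 n != 0)
    (a0 : a 0%N = zQ)
    (a1 : a 1%N = (2 * zQ + p ^+ 2 + q) / (p * q + r))
    (b0 : b 0%N = p)
    (b1 : b 1%N = - ((zQ ^+ 2 + q * zQ + p ^+ 2 * zQ - p * r) / (p * q + r)))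
    (a2 : forall k : nat, a (3 * k + 2)%N = (p * q + r) * T / D)
    (a3 : forall k : nat, a (3 * k + 3)%N = T)
    (a4 : forall k : nat, a (3 * k + 4)%N = T / (p * q + r))
    (b2 : forall k : nat, b (3 * k + 2)%N = - (I / D))
    (b3 : forall k : nat, b (3 * k + 3)%N = - ((p * q + r) * I / D))
    (b4 : forall k : nat, b (3 * k + 4)%N = - (I / (p * q + r))) :
  tcf_converges (fun n => ratr (a n) : R) (fun n => ratr (b n) : R)
    (ratr r / alpha) alpha.

Proof.
have s0 := cubic_pq_r_neq0 irr.
have D0 : D != 0 := cubicD_neq0 zQ irr.
have [u [v [uE vE pE qE rE]]] := cubic_vieta roots.
pose zR : R := z%:~R.
have zRE : ratr zQ = zR by rewrite /zQ ratr_int.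
have zCE : z%:~R = zR%:C :> R[i] by rewrite /zR rmorph_int.
pose beta := zR + alpha ^+ 2.
have betaE : z%:~R + alpha%:C ^+ 2 = beta%:C.
  by rewrite /beta rmorphD rmorphXn /= zCE.
(* Sum and product of z + alpha_2^2 and z + alpha_3^2, written in [u] and [v] to be visibly real. *)
pose S := 2 * zR + u ^+ 2 - 2 * v.
pose P := zR ^+ 2 + zR * (u ^+ 2 - 2 * v) + v ^+ 2.
rewrite betaE !zCE in zdom2 zdom3.
have SE : S%:C = (zR%:C + alpha2 ^+ 2) + (zR%:C + alpha3 ^+ 2).
  rewrite /S rmorphB rmorphD rmorphXn !rmorphM rmorph_nat /= uE vE; ring.
have PE : P%:C = (zR%:C + alpha2 ^+ 2) * (zR%:C + alpha3 ^+ 2).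
  rewrite /P !(rmorphD, rmorphN, rmorphXn, rmorphM, rmorph_nat) /= uE vE.
  ring.
have TE : ratr T = beta + S.
  rewrite /T /cubicT !rmorphD rmorphXn !rmorphM !rmorph_nat /= zRE pE qE.
  rewrite /beta /S; ring.
have IE : ratr I = beta * S + P.
  rewrite /I /cubicI !(rmorphD, rmorphN, rmorphXn, rmorphM, rmorph_nat) /=.
  rewrite zRE pE qE rE /beta /S /P; ring.
have DE : ratr D = beta * P.
  rewrite /D /cubicD !(rmorphD, rmorphN, rmorphXn, rmorphM, rmorph_nat) /=.
  rewrite zRE pE qE rE /beta /P; ring.
set aR := fun n => ratr (a n) : R; set bR := fun n => ratr (b n) : R.
pose s : R := ratr (p * q + r).
have sE : s = ratr p * ratr q + ratr r by rewrite /s rmorphD rmorphM.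
have sR0 : s != 0 by rewrite fmorph_eq0.
have DR0 : (ratr D : R) != 0 by rewrite fmorph_eq0.
pose c := tcf_scale s (ratr D).
have c0 n : c n != 0 by apply: tcf_scale_neq0.
pose Y x y w n := tcf_rec aR bR x y w n.+1 / c n.
have YE x y w n :
    Y x y w n.+3 = (beta + S) * Y x y w n.+2
      - (beta * S + P) * Y x y w n.+1 + beta * P * Y x y w n.
  rewrite -TE -IE -DE; apply: tcf_rec_scaled => // k; rewrite /aR /bR.
  - by rewrite a2 !(rmorphM, fmorphV).
  - by rewrite a3.
  - by rewrite a4 !(rmorphM, fmorphV).
  - by rewrite b2 !(rmorphN, rmorphM, fmorphV).
  - by rewrite b3 !(rmorphN, rmorphM, fmorphV).
  - by rewrite b4 !(rmorphN, rmorphM, fmorphV).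
have cvgY x y w := cvg_rec3_dominant SE PE zdom2 zdom3 (YE x y w).
set Q := beta ^+ 2 - S * beta + P in cvgY.
have beta0 : beta != 0.
  have := le_lt_trans (normr_ge0 _) zdom2.
  by rewrite normr_gt0; apply: contraNneq => ->.
have alpha0 : alpha != 0.
  have := le_lt_trans (normr_ge0 _) dom2.
  by rewrite normr_gt0; apply: contraNneq => ->.
have Y0E x y w : Y x y w 0%N = y by rewrite /Y /c /= divr1.
have Y1E x y w : Y x y w 1%N = w by rewrite /Y /c /= divr1.
(* The exceptional a_1 and b_1 and the initial value X_(-2) enter only through this term; the factor
   [s] comes from c_1 = 1 / s. *)
have Y2E x y w : Y x y w 2%N = s * aR 1%N * w + s * bR 1%N * y + s * x.
  by rewrite /Y /c /= invrK; ring.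
have a0E : aR 0%N = zR by rewrite /aR a0.
have b0E : bR 0%N = alpha + u by rewrite /bR b0 pE.
have a1E : s * aR 1%N = 2 * zR + (alpha + u) ^+ 2 - (alpha * u + v).
  rewrite /aR a1 rmorphM /= fmorphV -/s mulrC divfK //.
  by rewrite !(rmorphD, rmorphXn, rmorphM, rmorph_nat) /= zRE pE qE.
have b1E : s * bR 1%N = - (zR ^+ 2 - (alpha * u + v) * zR
    + (alpha + u) ^+ 2 * zR - (alpha + u) * (alpha * v)).
  rewrite /bR b1 rmorphN rmorphM /= fmorphV -/s mulrN mulrC divfK //.
  by rewrite !(rmorphD, rmorphN, rmorphXn, rmorphM) /= zRE pE qE rE mulNr.
pose F := alpha ^+ 2 + alpha * u + v.
(* A zero of (alpha + alpha_2)(alpha + alpha_3) would give alpha the modulus of another root. *)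
have F0 : F != 0.
  have FE : F%:C = (alpha%:C + alpha2) * (alpha%:C + alpha3).
    by rewrite /F !(rmorphD, rmorphXn, rmorphM) /= uE vE; ring.
  have : F%:C != 0.
    rewrite FE mulf_neq0 // addrC addr_eq0.
      by apply: contraTneq dom2 => ->; rewrite normrN ltxx.
    by apply: contraTneq dom3 => ->; rewrite normrN ltxx.
  by apply: contraNneq => ->.
have Q0 : Q != 0 := quadratic_neq0 SE PE zdom2 zdom3.
have cvgC : (Y 0 0 1 n / beta ^+ n @[n --> \oo] --> F / Q)%classic.
  have -> : F = Y 0 0 1 2%N - S * Y 0 0 1 1%N + P * Y 0 0 1 0%N.
    by rewrite Y0E Y1E Y2E a1E /F /S; ring.
  exact: cvgY.
have FQ0 : F / Q != 0 by rewrite mulf_neq0 ?invr_neq0.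
(* The common scale cancels; the n-th convergent sits at index n + 1 of [Y]. *)
have ratioE x y w : (fun n => tcf_rec aR bR x y w n.+2 / tcfC aR bR n) =
    (fun n => Y x y w n.+1 / Y 0 0 1 n.+1).
  by apply/funext => n; rewrite /Y /tcfC /tcfC_shift invf_div mulrA divfK.
split.
- have cvgCS : (Y 0 0 1 n.+1 / beta ^+ n.+1 @[n --> \oo] --> F / Q)%classic.
    by rewrite (cvg_shiftS (fun n => Y 0 0 1 n / beta ^+ n)).
  apply: filterS (cvgr_neq0 _ cvgCS FQ0) => n; apply: contraNneq => C0.
  by rewrite /Y -/(tcfC_shift aR bR n.+2) -/(tcfC aR bR n) C0 !mul0r.
- rewrite /tcfA /tcfA_shift ratioE.
  rewrite (cvg_shiftS (fun n => Y 0 1 (aR 0%N) n / Y 0 0 1 n)).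
  apply: cvg_ratio_dominant (cvgY _ _ _) cvgC => //.
  (* Here r / alpha = v, and the numerator is z F + (s b_1 + P) with s b_1 + P = (v - z) F. *)
  rewrite mulrA; congr (_ / _); rewrite Y0E Y1E Y2E a1E b1E a0E rE.
  by rewrite [alpha * v]mulrC mulfK // /F /S /P; ring.
- rewrite /tcfB /tcfB_shift ratioE.
  rewrite (cvg_shiftS (fun n => Y 1 0 (bR 0%N) n / Y 0 0 1 n)).
  apply: cvg_ratio_dominant (cvgY _ _ _) cvgC => //.
  (* The numerator is (alpha + u) F + s, and s = p q + r = - u F. *)
  rewrite mulrA; congr (_ / _); rewrite Y0E Y1E Y2E a1E b1E b0E sE pE qE rE.
  by rewrite /F /S; ring.
Qed.
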